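(* (a) For every integer $n\ge 1$, every $n$-REA Turing degree contains an NCR real. (b) Every self-modulus Turing degree contains an NCR real.
   Context: Reals are elements of $2^{\mathbb N}$; $[\sigma]$ denotes the set of reals extending the finite string $\sigma$. The space $\mathcal P(2^{\mathbb N})$ of Borel probability measures carries the metric $d(\mu,\nu)=\sum_{\sigma}2^{-|\sigma|}|\mu[\sigma]-\nu[\sigma]|$; a representation of $\mu$ is a real $R$ coding a sequence of indices of elements of a fixed effectively enumerated countable dense set (the closure of the Dirac measures at $\sigma0^\omega$ under binary averages) converging to $\mu$ with $d(\mu_{k},\mu_{k+1})\le 2^{-k}$. For a representation $R$ of $\mu$, a real $X$ is $R$-$\mu$-random if $X\notin\bigcap_n V_n$ for every sequence of uniformly $\Sigma^0_1(R)$ sets $(V_n)$ with $\mu(V_n)\le 2^{-n}$. A measure is continuous if every singleton has measure $0$. A real $X$ is NCR if there is no continuous probability measure $\mu$ and representation $R$ of $\mu$ such that $X$ is $R$-$\mu$-random. A real $B$ is r.e.a. (recursively enumerable above) $A$ if $B=W^A_e$ for some $e$ and $A\le_T B$. A real is 1-REA if it is recursively enumerable; it is $(n+1)$-REA if it is r.e.a. some $n$-REA real; a Turing degree is $n$-REA if it contains an $n$-REA real. A function $f$ dominates $g$ if $f(n)>g(n)$ for all but finitely many $n$. A function $f$ is a modulus for a real $A$ if every function dominating $f$ computes $A$; $A$ has a self-modulus if it has a modulus $f_A\equiv_T A$; a Turing degree is a self-modulus degree if it contains a real with a self-modulus. *)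

(* Defs.v *)
From HB Require Import structures.
From mathcomp Require Import all_boot all_order all_algebra.
From mathcomp Require Import all_classical all_reals all_analysis.
From Stdlib Require Cantor.

Set Implicit Arguments.
Unset Strict Implicit.
Unset Printing Implicit Defensive.

Import Order.TTheory GRing.Theory Num.Theory.
Import numFieldNormedType.Exports.

Local Open Scope classical_set_scope.
Local Open Scope ring_scope.

(* Elements of 2^N.  [cantor_space] is convertible to [nat -> bool]. *)
Definition real := cantor_space.

Definition char (A : real) : nat -> nat := fun n => A n : nat.

Definition cpair (x y : nat) : nat := Cantor.to_nat (x, y).

(* Unary mu-recursive functions over a pairing function: several arguments are
   passed as one paired number. *)
Inductive prog : Type :=
| Zero
| Succ
| Fst
| Snd
| Oracle
| Pair of prog & prog
| Comp of prog & prog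
| Prec of prog & prog
| Mu of prog.

(* [run g p x y]: the partial function computed by [p] with oracle [g] is
   defined at [x], with value [y]. *)
Fixpoint run (g : nat -> nat) (p : prog) (x y : nat) {struct p} : Prop :=
  match p with
  | Zero => y = 0%N
  | Succ => y = x.+1
  | Fst => y = (Cantor.of_nat x).1
  | Snd => y = (Cantor.of_nat x).2
  | Oracle => y = g x
  | Pair p q => exists u v, [/\ run g p x u, run g q x v & y = cpair u v]
  | Comp p q => exists2 u, run g q x u & run g p u y
  | Prec p q =>
      (* primitive recursion on the second component of [x]; [s] is the
         sequence of intermediate values *)
      let: (a, n) := Cantor.of_nat x in
      exists s : nat -> nat,
        [/\ run g p a (s 0%N),
            forall i, (i < n)%N -> run g q (cpair a (cpair i (s i))) (s i.+1)
          & y = s n]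
  | Mu p =>
      run g p (cpair x y) 0%N /\
      (forall z, (z < y)%N -> exists w, run g p (cpair x z) w.+1)
  end.

Definition halts (g : nat -> nat) (p : prog) (x : nat) : Prop :=
  exists y, run g p x y.

Definition computes (g f : nat -> nat) : Prop :=
  exists p, forall n, run g p n (f n).

Definition turing_le (A B : real) : Prop := computes (char B) (char A).

Definition turing_eq (A B : real) : Prop := turing_le A B /\ turing_le B A.

Definition turing_degree (D : set real) : Prop :=
  exists A : real, D = [set B | turing_eq B A].

Definition re_in (A B : real) : Prop :=
  exists p, forall n, B n <-> halts (char A) p n.

Definition re (B : real) : Prop := re_in (fun=> false) B.

Definition rea (A B : real) : Prop := re_in A B /\ turing_le A B.

Inductive nREA : nat -> real -> Prop :=
| nREA_1 B : re B -> nREA 1 B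
| nREA_S n A B : nREA n A -> rea A B -> nREA n.+1 B.

Definition nREA_degree (n : nat) (D : set real) : Prop :=
  turing_degree D /\ exists2 A, D A & nREA n A.

Definition dominates (f g : nat -> nat) : Prop :=
  exists N, forall n, (N <= n)%N -> (g n < f n)%N.

Definition modulus (f : nat -> nat) (A : real) : Prop :=
  forall g, dominates g f -> computes g (char A).

Definition has_self_modulus (A : real) : Prop :=
  exists f, [/\ modulus f A, computes (char A) f & computes f (char A)].

Definition self_modulus_degree (D : set real) : Prop :=
  turing_degree D /\ exists2 A, D A & has_self_modulus A.

Definition cantor_borel : measurableType _ :=
  g_sigma_algebraType (@open cantor_space).

Definition cylinder (s : seq bool) : set cantor_borel :=
  [set X | mkseq X (size s) = s].

Definition finite_ext (s : seq bool) : cantor_borel := nth false s.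

Section average.
Context {d : measure_display} {T : measurableType d} {R : realType}.
Context (mu nu : probability T R).

Definition average : set T -> \bar R :=
  mscale (2^-1)%:nng (measure_add mu nu).

HB.instance Definition _ := Measure.copy average
  (mscale (2^-1)%:nng (measure_add mu nu)).

Lemma averageE A : average A = ((2^-1)%:E * (mu A + nu A))%E.
Proof. by rewrite -measure_addE. Qed.

Lemma average_setT : average setT = 1%E.
Proof.
by rewrite averageE !probability_setT -EFinD -EFinM mulVf// pnatr_eq0.
Qed.

HB.instance Definition _ :=
  Measure_isProbability.Build _ _ _ average average_setT.
End average.

(* Formal names for the elements of the dense set: the closure of the Dirac
   measures at [s 0 0 0 ...] under binary averages. *)
Inductive name : Type :=
| Dirac of seq bool
| Average of name & name.

Fixpoint name_measure (R : realType) (t : name) : probability cantor_borel R :=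
  match t with
  | Dirac s => (\d_(finite_ext s) : probability cantor_borel R)
  | Average t u => (average (name_measure R t) (name_measure R u)
                     : probability cantor_borel R)
  end.

(* The bijection [seq bool -> nat] given by binary notation with digits 1, 2. *)
Fixpoint string_code (s : seq bool) : nat :=
  match s with
  | [::] => 0
  | b :: s => ((string_code s).*2 + b).+1
  end.

(* A bijection [name -> nat]; its inverse is the effective enumeration of the
   dense set. *)
Fixpoint name_index (t : name) : nat :=
  match t with
  | Dirac s => (string_code s).*2
  | Average t u => (cpair (name_index t) (name_index u)).*2.+1
  end.

Definition measure_dist (R : realType) (mu nu : probability cantor_borel R)
    : \bar R :=
  (\esum_(s in [set: seq bool])
     ((2 ^- size s)%:E * `| mu (cylinder s) - nu (cylinder s) |))%E.

(* A real codes a sequence of numbers as (the paired version of) its graph. *)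
Definition codes_sequence (A : real) (f : nat -> nat) : Prop :=
  forall k m, A (cpair k m) <-> f k = m.

Definition representation (R : realType) (A : real)
    (mu : probability cantor_borel R) : Prop :=
  exists t : nat -> name,
    [/\ codes_sequence A (fun k => name_index (t k)),
        forall k, (measure_dist (name_measure R (t k)) (name_measure R (t k.+1))
                   <= (2 ^- k)%:E)%E
      & (fun k => measure_dist (name_measure R (t k)) mu) @ \oo --> 0%E].

Definition uniformly_Sigma1 (A : real) (V : nat -> set cantor_borel) : Prop :=
  exists p, forall n,
    V n = \bigcup_(s in [set s | halts (char A) p (cpair n (string_code s))])
            cylinder s.

Definition random (R : realType) (A : real) (mu : probability cantor_borel R)
    (X : real) : Prop :=
  forall V : nat -> set cantor_borel,
    uniformly_Sigma1 A V ->
    (forall n, (mu (V n) <= (2 ^- n)%:E)%E) ->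
    ~ (\bigcap_n V n) X.

Definition continuous_measure (R : realType)
    (mu : probability cantor_borel R) : Prop :=
  forall X : cantor_borel, mu [set X] = 0%E.

Definition NCR (R : realType) (X : real) : Prop :=
  ~ exists (mu : probability cantor_borel R) (A : real),
      [/\ continuous_measure mu, representation A mu & random A mu X].

(* Main.v *)
(* Both parts follow from one construction.  An n-REA real has a self-modulus:
   if B is r.e. in A <=_T B and f is a self-modulus of A, add to f the settling
   time of the enumeration of B relative to A.

   Let f be a self-modulus of B, and let X have its elements x_0 < x_1 < ... so
   far apart that f n < x_n and f computes X; then X and B are Turing equivalent.
   Let mu be a continuous measure with representation A.  The set of reals that
   vanish on [L, l) shrinks to a countable set as l grows, so A can find an l = h L
   making its measure at most 2^-L.  If X has infinitely many gaps reaching from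
   x_n + 1 beyond h (x_n + 1), then X fails the test made of these sets.
   Otherwise x_(n+1) <= h (x_n + 1) for almost all n, so iterating h yields an
   A-computable function dominating f; then A computes B, hence X, and X fails
   the test made of its own initial segments. *)
Require Import Defs.
From mathcomp Require Import all_boot all_order all_algebra.
From mathcomp Require Import all_classical all_reals all_analysis.
From mathcomp Require Import finmap zify ring lra.
From Stdlib Require Cantor.

Set Implicit Arguments.
Unset Strict Implicit.
Unset Printing Implicit Defensive.

Import Order.TTheory GRing.Theory Num.Theory.
Import numFieldNormedType.Exports.

Local Open Scope classical_set_scope.
Local Open Scope ring_scope.
Local Open Scope nat_scope.

(** * Computability *)

Definition p1 (z : nat) : nat := (Cantor.of_nat z).1.
Definition p2 (z : nat) : nat := (Cantor.of_nat z).2.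

Lemma p1_cpair x y : p1 (cpair x y) = x.
Proof. by rewrite /p1 /cpair Cantor.cancel_of_to. Qed.

Lemma p2_cpair x y : p2 (cpair x y) = y.
Proof. by rewrite /p2 /cpair Cantor.cancel_of_to. Qed.

Lemma cpairK z : cpair (p1 z) (p2 z) = z.
Proof. by rewrite /p1 /p2 /cpair -surjective_pairing Cantor.cancel_to_of. Qed.

Lemma leq_cpair x y : x + y <= cpair x y.
Proof. have := Cantor.to_nat_non_decreasing x y; rewrite /cpair; lia. Qed.

Definition pE := (p1_cpair, p2_cpair).

Lemma computes_ext g f f' : f =1 f' -> computes g f -> computes g f'.
Proof. by move=> ff' [p hp]; exists p => n; rewrite -ff'. Qed.

Fixpoint prog_subst (p q : prog) : prog :=
  match p with
  | Oracle => q
  | Pair a b => Pair (prog_subst a q) (prog_subst b q)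
  | Comp a b => Comp (prog_subst a q) (prog_subst b q)
  | Prec a b => Prec (prog_subst a q) (prog_subst b q)
  | Mu a => Mu (prog_subst a q)
  | p => p
  end.

Lemma run_subst g f p q : (forall n, run g q n (f n)) ->
  forall x y, run f p x y -> run g (prog_subst p q) x y.
Proof.
move=> qf; elim: p => //= [x y -> //|a iha b ihb|a iha b ihb|a iha b ihb|a iha] x y.
- by case=> u [v [hu hv ->]]; exists u, v; split; auto.
- by case=> u hu hy; exists u; auto.
- case: (Cantor.of_nat x) => c n [s [h0 hs hy]]; exists s; split; auto.
- case=> h0 hz; split; first by auto.
  by move=> z /hz[w hw]; exists w; auto.
Qed.

Lemma computes_trans g f h : computes g f -> computes f h -> computes g h.
Proof.
move=> [q hq] [p hp]; exists (prog_subst p q) => n.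
exact: (run_subst hq (hp n)).
Qed.

(* [ev g p s x] is [y.+1] if [p], with unbounded searches cut off at [s], yields
   [y] at [x], and [0] if it yields no value. *)
Fixpoint ev (g : nat -> nat) (p : prog) (s x : nat) : nat :=
  match p with
  | Zero => 1
  | Succ => x.+2
  | Fst => (p1 x).+1
  | Snd => (p2 x).+1
  | Oracle => (g x).+1
  | Pair p q => if (0 < ev g p s x) && (0 < ev g q s x)
                then (cpair (ev g p s x).-1 (ev g q s x).-1).+1 else 0
  | Comp p q => if 0 < ev g q s x then ev g p s (ev g q s x).-1 else 0
  | Prec p q =>
      iteri (p2 x) (fun i r => if 0 < r
        then ev g q s (cpair (p1 x) (cpair i r.-1)) else 0) (ev g p s (p1 x))
  | Mu p => let z := find (fun z => ev g p s (cpair x z) <= 1) (iota 0 s) in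
            if (z < s) && (ev g p s (cpair x z) == 1) then z.+1 else 0
  end.

Lemma ev_sound g p s x y : ev g p s x = y.+1 -> run g p x y.
Proof.
elim: p x y => /= [|||||
  p ihp q ihq|p ihp q ihq|p ihp q ihq|p ihp] x y; try by case=> <-.
- case hp: (ev g p s x) => [|u]; case hq: (ev g q s x) => [|v] //= [<-].
  by exists u, v; split; auto.
- by case hq: (ev g q s x) => [|v] //= hp; exists v; auto.
- rewrite -(cpairK x) /cpair Cantor.cancel_of_to -/(cpair _ _) !pE.
  set F := fun i r => _; set e0 := ev g p s _ => hy.
  (* Once a round yields 0, [F] keeps it at 0, so a positive last value makes every earlier one
     positive. *)
  have pos i : i <= p2 x -> 0 < iteri i F e0.
    move=> ile; have: 0 < iteri (p2 x) F e0 by rewrite hy.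
    rewrite -(subnK ile); elim: (p2 x - i) => // m ih.
    by rewrite addSn /= {1}/F; case: ifP => // /ih.
  exists (fun i => (iteri i F e0).-1); split=> [|i ilt|]; last by rewrite hy.
    by apply: ihp; rewrite prednK // (pos 0).
  apply: ihq; rewrite prednK; last exact: pos.
  by rewrite [RHS]/= [in RHS]/F ifT //; exact: pos (ltnW ilt).
(* The search stops at the first [z] where [ev] is 0 (no value) or 1 (value zero). Below it [ev] is
   at least 2, which gives the positive values that [Mu] asks for. *)
- set t := fun z => _; set z := find _ _; case: ifP => // /andP[zs /eqP ev1] [<-].
  split; first exact: ihp.
  move=> w wz; have := before_find 0 wz; rewrite nth_iota ?(ltn_trans wz) //= add0n.
  rewrite /t; case hw: (ev g p s (cpair x w)) => [|[|u]] // _.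
  by exists u; apply: ihp.
Qed.

(** The claim covers all late stages, not just one, so that the stages of finitely many
    subcomputations can be merged by [maxn]. *)
Lemma ev_complete g p x y : run g p x y ->
  exists s0, forall s, s0 <= s -> ev g p s x = y.+1.
Proof.
elim: p x y => /= [|||||
  p ihp q ihq|p ihp q ihq|p ihp q ihq|p ihp] x y; try by move=> ->; exists 0.
- move=> [u [v [/ihp[s1 h1] /ihq[s2 h2] ->]]]; exists (maxn s1 s2) => s.
  by rewrite geq_max => /andP[/h1-> /h2->].
- move=> [u /ihq[s1 h1] /ihp[s2 h2]]; exists (maxn s1 s2) => s.
  by rewrite geq_max => /andP[/h1-> /h2].
- rewrite -(cpairK x) /cpair Cantor.cancel_of_to -/(cpair _ _) !pE.
  move=> [r [/ihp[s0 h0] hr ->]]; elim: (p2 x) hr => [|n ihn] hr.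
    by exists s0 => s /h0.
  have [i ilt|s1 h1] := ihn; first by apply: hr; exact: ltnW.
  have [s2 h2] := ihq _ _ (hr n (leqnn _)).
  exists (maxn s1 s2) => s; rewrite geq_max => /andP[/h1 e1 /h2 e2].
  by rewrite /= e1.
- move=> [/ihp[s0 h0] hz].
  have [s1 h1] : exists s1, forall s z, s1 <= s -> z < y -> 1 < ev g p s (cpair x z).
    elim: y hz {h0} => [|y ihy] hz; first by exists 0.
    have [z zy|s1 h1] := ihy; first by apply: hz; exact: ltnW.
    have [w /ihp[s2 h2]] := hz y (leqnn _).
    exists (maxn s1 s2) => s z; rewrite geq_max => /andP[le1 /h2 e2].
    by rewrite ltnS leq_eqVlt => /orP[/eqP->|/h1->//]; rewrite e2.
  (* A stage beyond [y] puts [y] into the searched list; [s0] settles the value at [y], and [s1] all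
     the values before it. *)
  exists (maxn y.+1 (maxn s0 s1)) => s; rewrite !geq_max => /and3P[ys /h0 e0 /h1 e1].
  have -> : find (fun z => ev g p s (cpair x z) <= 1) (iota 0 s) = y.
    rewrite -[in iota _ _](subnKC ys) -[y.+1]addn1 -addnA iotaD find_cat ifN; last first.
      rewrite -all_predC; apply/allP => z; rewrite mem_iota add0n /= => zy.
      by rewrite -ltnNge; exact: e1.
    by rewrite size_iota add0n add1n /= e0 addn0.
  by rewrite ys e0 eqxx.
Qed.

(** [ev] is a function, and both results appear at a common late stage. *)
Lemma run_functional g p x y z : run g p x y -> run g p x z -> y = z.
Proof.
move=> /ev_complete[s hs] /ev_complete[t ht].
by have := hs _ (leq_maxl s t); rewrite ht ?leq_maxr // => -[].
Qed.

(** * Closure properties of the functions computable from a fixed oracle *)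

Section Closure.
Variable g : nat -> nat.
Implicit Types (a b : nat -> nat).

Lemma computes_oracle : computes g g.
Proof. by exists Oracle. Qed.

Lemma computes_comp f a :
  computes g f -> computes g a -> computes g (fun x => f (a x)).
Proof. by move=> [p hp] [q hq]; exists (Comp p q) => n /=; exists (a n). Qed.

Lemma computes_succ a : computes g a -> computes g (fun x => (a x).+1).
Proof. by apply: (@computes_comp succn); exists Succ. Qed.

Lemma computes_p1 a : computes g a -> computes g (fun x => p1 (a x)).
Proof. by apply: computes_comp; exists Fst. Qed.

Lemma computes_p2 a : computes g a -> computes g (fun x => p2 (a x)).
Proof. by apply: computes_comp; exists Snd. Qed.

Lemma computes_cpair a b :
  computes g a -> computes g b -> computes g (fun x => cpair (a x) (b x)).
Proof.
move=> [p hp] [q hq]; exists (Pair p q) => n /=.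
by exists (a n), (b n).
Qed.

Lemma computes_id : computes g (fun x => x).
Proof.
apply: (computes_ext cpairK); apply: computes_cpair; by [exists Fst|exists Snd].
Qed.

Lemma computes_const k : computes g (fun=> k).
Proof.
elim: k => [|k ih]; first by exists Zero.
exact: computes_succ.
Qed.

Lemma computes_comp2 (f : nat -> nat -> nat) a b :
  computes g (fun z => f (p1 z) (p2 z)) -> computes g a -> computes g b ->
  computes g (fun x => f (a x) (b x)).
Proof.
move=> hf ha hb; have := computes_comp hf (computes_cpair ha hb).
by apply: computes_ext => x; rewrite !pE.
Qed.

Lemma computes_iteri n (q : nat -> nat -> nat -> nat) a : computes g n ->
  computes g (fun z => q (p1 z) (p1 (p2 z)) (p2 (p2 z))) -> computes g a ->
  computes g (fun x => iteri (n x) (q x) (a x)).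
Proof.
move=> hn [Q hQ] [P hP].
(* [Prec] carries one parameter. It is taken to be the whole input, from which [a] and [q] are
   evaluated; the number of rounds is plugged in at the end. *)
have hf : computes g (fun z => iteri (p2 z) (q (p1 z)) (a (p1 z))).
  exists (Prec P Q) => z /=.
  rewrite -(cpairK z) !pE /cpair Cantor.cancel_of_to.
  exists (fun i => iteri i (q (p1 z)) (a (p1 z))); split=> // i _ /=.
  by have := hQ (cpair (p1 z) (cpair i (iteri i (q (p1 z)) (a (p1 z))))); rewrite !pE.
exact: (computes_comp2 (f := fun c m => iteri m (q c) (a c))) hf computes_id hn.
Qed.

Lemma computes_iter n (f : nat -> nat -> nat) a : computes g n ->
  computes g (fun z => f (p1 z) (p2 z)) -> computes g a ->
  computes g (fun x => iter (n x) (f x) (a x)).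
Proof.
move=> hn hf ha.
apply: (@computes_ext _ (fun x => iteri (n x) (fun _ => f x) (a x))) => [x|].
  by elim: (n x) => //= m ->.
apply: computes_iteri => //; apply: (computes_comp2 (f := f)) => //.
  exact/computes_p1/computes_id.
exact/computes_p2/computes_p2/computes_id.
Qed.

(* [Mu] searches for a zero, hence the negation of [t]. *)
Lemma computes_search (t : nat -> pred nat) : (forall x, exists y, t x y) ->
  computes g (fun z => ~~ t (p1 z) (p2 z)) ->
  exists2 m, computes g m & forall x, t x (m x).
Proof.
move=> ex [p hp]; exists (fun x => ex_minn (ex x)); last by move=> x; case: ex_minnP.
exists (Mu p) => x /=; case: ex_minnP => y ty miny; split.
  by have := hp (cpair x y); rewrite !pE ty.
move=> z zy; exists 0; have := hp (cpair x z); rewrite !pE.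
by case: (boolP (t x z)) => // /miny; rewrite leqNgt zy.
Qed.

(** An unbounded search halts exactly when a witness exists; this presents the randomness tests as
    uniformly r.e. sets of strings. *)
Lemma halts_search (t : nat -> pred nat) :
  computes g (fun z => ~~ t (p1 z) (p2 z)) ->
  exists p, forall x, halts g p x <-> exists y, t x y.
Proof.
move=> [p hp]; exists (Mu p) => x; split=> [[y /= [h0 _]]|ex].
  exists y; have := hp (cpair x y); rewrite !pE => h1.
  by have := run_functional h0 h1; case: (t x y).
exists (ex_minn ex); case: ex_minnP => y ty miny /=; split.
  by have := hp (cpair x y); rewrite !pE ty.
move=> z zy; exists 0; have := hp (cpair x z); rewrite !pE.
by case: (boolP (t x z)) => // /miny; rewrite leqNgt zy.
Qed.

Lemma computes_pred a : computes g a -> computes g (fun x => (a x).-1).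
Proof.
(* Each round returns its own index, and the last of [x] rounds has index [x.-1]. *)
apply: computes_comp; apply: (@computes_ext _ (fun x => iteri x (fun i _ => i) 0)).
  by case.
apply: (computes_iteri (q := fun _ i _ => i)); [exact: computes_id| |exact: computes_const].
exact/computes_p1/computes_p2/computes_id.
Qed.

Lemma computes_add a b :
  computes g a -> computes g b -> computes g (fun x => a x + b x).
Proof.
move=> ha hb; apply: (@computes_ext _ (fun x => iter (b x) succn (a x))) => [x|].
  by rewrite iter_succn.
apply: (computes_iter (f := fun=> succn)) => //.
exact/computes_succ/computes_p2/computes_id.
Qed.

Lemma computes_sub a b :
  computes g a -> computes g b -> computes g (fun x => a x - b x).
Proof.
move=> ha hb; apply: (@computes_ext _ (fun x => iter (b x) predn (a x))) => [x|].
  by rewrite iter_predn.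
apply: (computes_iter (f := fun=> predn)) => //.
exact/computes_pred/computes_p2/computes_id.
Qed.

Lemma computes_mul a b :
  computes g a -> computes g b -> computes g (fun x => a x * b x).
Proof.
move=> ha hb; apply: (@computes_ext _ (fun x => iter (b x) (addn (a x)) 0)) => [x|].
  by rewrite iter_addn_0.
apply: (computes_iter (f := fun x => addn (a x))) => //; last exact: computes_const.
apply: computes_add; last exact/computes_p2/computes_id.
exact/(computes_comp ha)/computes_p1/computes_id.
Qed.

Lemma computes_exp a b :
  computes g a -> computes g b -> computes g (fun x => a x ^ b x).
Proof.
move=> ha hb; apply: (@computes_ext _ (fun x => iter (b x) (muln (a x)) 1)) => [x|].
  by elim: (b x) => //= m ->; rewrite expnS.
apply: (computes_iter (f := fun x => muln (a x))) => //; last exact: computes_const.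
apply: computes_mul; last exact/computes_p2/computes_id.
exact/(computes_comp ha)/computes_p1/computes_id.
Qed.

Lemma computes_leq a b :
  computes g a -> computes g b -> computes g (fun x => a x <= b x).
Proof.
move=> ha hb; apply: (@computes_ext _ (fun x => 1 - (a x - b x))) => [x|].
  by rewrite /leq; case: (a x - b x).
by apply: computes_sub; [exact: computes_const|exact: computes_sub].
Qed.

Lemma computes_neg (t : pred nat) : computes g t -> computes g (fun x => ~~ t x).
Proof.
move=> ht; apply: (@computes_ext _ (fun x => 1 - t x)) => [x|].
  by case: (t x).
by apply: computes_sub => //; exact: computes_const.
Qed.

Lemma computes_and (t u : pred nat) :
  computes g t -> computes g u -> computes g (fun x => t x && u x).
Proof.
move=> ht hu; apply: (@computes_ext _ (fun x => t x * u x)) => [x|].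
  by case: (t x); case: (u x).
exact: computes_mul.
Qed.

Lemma computes_or (t u : pred nat) :
  computes g t -> computes g u -> computes g (fun x => t x || u x).
Proof.
move=> ht hu; apply: (@computes_ext _ (fun x => ~~ (~~ t x && ~~ u x))) => [x|].
  by case: (t x); case: (u x).
by apply/computes_neg/computes_and; apply: computes_neg.
Qed.

Lemma computes_eq a b :
  computes g a -> computes g b -> computes g (fun x => a x == b x).
Proof.
move=> ha hb; apply: (@computes_ext _ (fun x => (a x <= b x) && (b x <= a x))).
  by move=> x; rewrite eqn_leq.
by apply: computes_and; apply: computes_leq.
Qed.

Lemma computes_if (t : pred nat) a b : computes g t -> computes g a ->
  computes g b -> computes g (fun x => if t x then a x else b x).
Proof.
move=> ht ha hb.
apply: (@computes_ext _ (fun x => t x * a x + ~~ t x * b x)) => [x|].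
  by case: (t x); rewrite ?mul1n ?mul0n ?addn0.
by apply: computes_add; apply: computes_mul => //; exact: computes_neg.
Qed.

Lemma computes_odd a : computes g a -> computes g (fun x => odd (a x)).
Proof.
move=> ha; apply: (@computes_ext _ (fun x => iter (a x) (fun r => 1 - r) 0)) => [x|].
  by elim: (a x) => //= m ->; case: (odd m).
apply: (computes_iter (f := fun=> subn 1)) => //; last exact: computes_const.
by apply: computes_sub; [exact: computes_const|exact/computes_p2/computes_id].
Qed.

Lemma computes_half a : computes g a -> computes g (fun x => (a x)./2).
Proof.
move=> ha.
apply: (@computes_ext _ (fun x => iteri (a x) (fun i r => r + odd i) 0)) => [x|].
  by elim: (a x) => //= m ->; rewrite addnC -uphalf_half.
apply: (computes_iteri (q := fun _ i r => r + odd i)) => //; last exact: computes_const.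
apply: computes_add; first exact/computes_p2/computes_p2/computes_id.
exact/computes_odd/computes_p1/computes_p2/computes_id.
Qed.

Lemma computes_find (t : nat -> pred nat) n :
  computes g (fun z => t (p1 z) (p2 z)) -> computes g n ->
  computes g (fun x => find (t x) (iota 0 (n x))).
Proof.
move=> ht hn.
(* Before round [i], [r < i] records a hit and [r = i] means none so far, in line with [find]
   returning the length when it fails. *)
pose q x i r := if r < i then r else i + ~~ t x i.
apply: (@computes_ext _ (fun x => iteri (n x) (q x) 0)) => [x|].
  elim: (n x) => // m ih; rewrite [LHS]/= ih /q -[m.+1]addn1 iotaD find_cat has_find size_iota.
  by case: ifP => //= _; case: (t x m).
apply: computes_iteri => //; last exact: computes_const.
have hr : computes g (fun z => p2 (p2 z)) by exact/computes_p2/computes_p2/computes_id.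
have hi : computes g (fun z => p1 (p2 z)) by exact/computes_p1/computes_p2/computes_id.
apply: computes_if => //; first by apply: computes_leq => //; exact: computes_succ.
apply: computes_add => //.
apply: (computes_comp2 (f := fun x i => ~~ t x i)) => //; first exact: computes_neg.
exact/computes_p1/computes_id.
Qed.

Lemma computes_all (t : nat -> pred nat) n :
  computes g (fun z => t (p1 z) (p2 z)) -> computes g n ->
  computes g (fun x => all (t x) (iota 0 (n x))).
Proof.
move=> ht hn.
apply: (@computes_ext _ (fun x => find (predC (t x)) (iota 0 (n x)) == n x)) => [x|].
  congr nat_of_bool; rewrite -[all _ _]negbK -has_predC has_find size_iota -leqNgt.
  have := find_size (predC (t x)) (iota 0 (n x)); rewrite size_iota => le.
  by rewrite eqn_leq le.
apply: computes_eq => //; apply: (computes_find (t := fun x => predC (t x))) => //.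
exact: computes_neg.
Qed.

End Closure.

(* Premises may come out eta-reduced, hence the cases without a [fun]. *)
Ltac comp := repeat lazymatch goal with
  | h : computes ?g ?f |- computes ?g ?f => exact: h
  | |- computes _ (fun=> ?k) => exact: (@computes_const _ k)
  | |- computes _ (fun x => x) => exact: computes_id
  | |- computes _ p1 => exact: computes_p1 (computes_id _)
  | |- computes _ p2 => exact: computes_p2 (computes_id _)
  | |- computes _ predn => exact: computes_pred (computes_id _)
  | |- computes _ succn => exact: computes_succ (computes_id _)
  | |- computes _ (fun x => _.+1) => apply: computes_succ
  | |- computes _ (fun x => _.-1) => apply: computes_pred
  | |- computes _ (fun x => p1 _) => apply: computes_p1
  | |- computes _ (fun x => p2 _) => apply: computes_p2
  | |- computes _ (fun x => cpair _ _) => apply: computes_cpair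
  | |- computes _ (fun x => nat_of_bool (_ && _)) => apply: computes_and
  | |- computes _ (fun x => nat_of_bool (_ || _)) => apply: computes_or
  | |- computes _ (fun x => nat_of_bool (~~ _)) => apply: computes_neg
  | |- computes _ (fun x => nat_of_bool (_ <= _)) => apply: computes_leq
  | |- computes _ (fun x => nat_of_bool (_ == _)) => apply: computes_eq
  | |- computes _ (fun x => nat_of_bool (odd _)) => apply: computes_odd
  | |- computes _ (fun x => _./2) => apply: computes_half
  | |- computes _ (fun x => if _ then _ else _) => apply: computes_if
  | |- computes _ (fun x => _ + _) => apply: computes_add
  | |- computes _ (fun x => _ - _) => apply: computes_sub
  | |- computes _ (fun x => _ * _) => apply: computes_mul
  | |- computes _ (fun x => _ ^ _) => apply: computes_exp
  end.

(** The program is fixed, so induction on it does the work of a universal machine; the cut-off makes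
    every search bounded. *)
Lemma computes_ev g p : computes g (fun z => ev g p (p1 z) (p2 z)).
Proof.
elim: p => [||||| p ihp q ihq| p ihp q ihq| p ihp q ihq|p ihp]; rewrite /=.
1-4: by comp.
- by comp; apply: computes_comp; comp; exact: computes_oracle.
- by comp.
- by comp; apply: (computes_comp2 (f := ev g p)); comp.
- apply: (computes_iteri (q := fun z i r => if 0 < r then
    ev g q (p1 z) (cpair (p1 (p2 z)) (cpair i r.-1)) else 0)); comp.
    by apply: (computes_comp2 (f := ev g q)); comp.
  by apply: (computes_comp2 (f := ev g p)); comp.
have hf : computes g (fun z =>
    find (fun i => ev g p (p1 z) (cpair (p2 z) i) <= 1) (iota 0 (p1 z))).
  apply: (computes_find (t := fun z i => ev g p (p1 z) (cpair (p2 z) i) <= 1)); comp.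
  by apply: (computes_comp2 (f := ev g p)); comp.
by comp; apply: (computes_comp2 (f := ev g p)); comp.
Qed.

(** Finitely many values are patched, the last one first. Domination gives control only over almost
    all arguments, which makes this necessary. *)
Lemma computes_eventually g f f' N :
  (forall n, N <= n -> f n = f' n) -> computes g f -> computes g f'.
Proof.
elim: N f => [|N ih] f ff' hf; first by apply: computes_ext hf => n; exact: ff'.
apply: (ih (fun n => if n == N then f' N else f n)); last by comp.
by move=> n; rewrite leq_eqVlt eq_sym; case: eqP => [-> //|_ /=]; exact: ff'.
Qed.

(** * Self-moduli and their passage along r.e.a. steps *)

Lemma modulus_self f A : modulus f A -> computes f (char A).
Proof.
move=> mfA; apply: computes_trans (mfA (fun n => (f n).+1) _); last by exists 0.
by comp; exact: computes_oracle.
Qed.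

(** A bound on [f] recovers [A], and then a bound on the settling time [c] decides [B] by a bounded
    inspection of the enumeration. The sum [f + c] provides both bounds. *)
Lemma has_self_modulus_rea A B :
  rea A B -> has_self_modulus A -> has_self_modulus B.
Proof.
move=> [[p hp] AB] [f [mfA fA _]].
have evA : computes (char A) (fun z => ev (char A) p (p1 z) (p2 z)).
  exact: computes_ev.
(* The implication makes the search total: outside [B] any stage will do. *)
have [n||c hc ec] := @computes_search (char B)
    (fun n s => B n ==> (0 < ev (char A) p s n)).
- case: (boolP (B n)) => [/hp[y /ev_complete[s hs]]|_]; last by exists 0.
  by exists s; rewrite hs.
- apply: (@computes_ext _ (fun z => B (p1 z) && ~~ (0 < ev (char A) p (p2 z) (p1 z)))).
    by move=> z; rewrite negb_imply.
  comp; first by apply: (computes_comp (computes_oracle _)); comp.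
  apply: (computes_comp2 (f := ev (char A) p)); comp.
  exact: computes_trans AB evA.
have mf : modulus (fun n => f n + c n) B.
  move=> g [N gN].
  have gA : computes g (char A) by apply: mfA; exists N => n /gN; lia.
  pose t n s := ev (char A) p s n == 0.
  (* All stages below [g n] are inspected, and [c n] is one of them as soon as [N <= n]. *)
  apply: (@computes_eventually _ (fun n => ~~ all (t n) (iota 0 (g n))) _ N).
    move=> n Nn; congr nat_of_bool; apply/idP/idP.
      case/allPn => s _; rewrite /t; case e: (ev _ _ _ _) => [|y] // _.
      by apply/hp; exists y; exact: ev_sound e.
    move=> Bn; apply/allPn; exists (c n); last by have := ec n; rewrite Bn /t lt0n.
    by rewrite mem_iota /=; have := gN n Nn; lia.
  comp; apply: (computes_all (t := t)); last exact: computes_oracle.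
  rewrite /t; comp; apply: (computes_comp2 (f := ev (char A) p)); comp.
  exact: computes_trans gA evA.
exists (fun n => f n + c n); split=> //; last exact: modulus_self.
by comp; exact: computes_trans AB fA.
Qed.

(** Induction from the empty set: it has the zero function as a self-modulus, and an r.e. real is
    r.e.a. the empty set. *)
Lemma nREA_self_modulus n A : nREA n A -> has_self_modulus A.
Proof.
have zero_computable g : computes g (char (fun=> false)) by exact: computes_const.
elim=> {n A} [B reB|n A B _ ih AB]; last exact: has_self_modulus_rea AB ih.
apply: (@has_self_modulus_rea (fun=> false)); first by split; [exact: reB|exact: zero_computable].
by exists (fun=> 0); split=> [g _| |] //; exact: computes_const.
Qed.

(** The sequence [x] itself need not be computable: from the single number [x N], iterating a
    majorant of [h] stays above all later terms. *)
Lemma dominates_of_growth g f x h N : computes g h ->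
  (forall n, f n < x n) -> (forall n, N <= n -> x n.+1 <= h (x n)) ->
  exists2 G, computes g G & dominates G f.
Proof.
move=> hh fx xh.
(* Summing [h] up to [m] bounds [h i] for every [i <= m], so upper bounds survive iteration even
   when [h] is not monotone. *)
pose H m := iteri m.+1 (fun i r => r + h i) 0.
have leH i m : i <= m -> h i <= H m.
  by elim: m => [|m ih]; rewrite leq_eqVlt => /predU1P[->|//]; rewrite /H /=;
    rewrite ?leq_addl // => /ih; rewrite /H /=; lia.
exists (fun n => iter (n - N) H (x N)).
  apply: (computes_iter (f := fun=> H)); comp.
  apply: (computes_iteri (q := fun _ i r => r + h i)); comp.
  by apply: (computes_comp hh); comp.
exists N => n /subnKC<-; rewrite addKn; apply: leq_trans (fx _) _.
elim: (n - N) => [|j ih]; first by rewrite addn0.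
by rewrite addnS iterS; apply: leq_trans (xh _ (leq_addr _ _)) (leH _ _ ih).
Qed.

(** * Computing the measure of a named element of the dense set *)

(** A nonzero code less one has the first bit as its parity and the tail as its half. Code 0, the
    empty string, is its own tail, so bits past the end read as [false], as with [nth false]. *)
Definition code_tail (c : nat) : nat := c.-1./2.
Definition code_bit (c i : nat) : bool := odd (iter i code_tail c).-1.

Lemma code_tail_cons b s : code_tail (string_code (b :: s)) = string_code s.
Proof. by rewrite /code_tail /= addnC half_bit_double. Qed.

Lemma iter_code_tail0 i : iter i code_tail 0 = 0.
Proof. by elim: i => //= i ->. Qed.

Lemma code_bit_nth s i : code_bit (string_code s) i = nth false s i.
Proof.
rewrite /code_bit; elim: s i => [|b s ih] [|i]; rewrite ?nth_nil ?iterSr ?code_tail_cons //=.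
- by rewrite iter_code_tail0.
- by rewrite oddD odd_double oddb.
Qed.

Lemma code_size s i : (0 < iter i code_tail (string_code s)) = (i < size s).
Proof.
elim: s i => [|b s ih] [|i]; rewrite ?iterSr ?code_tail_cons //=.
by rewrite iter_code_tail0.
Qed.

Lemma computes_code_tail g a :
  computes g a -> computes g (fun x => code_tail (a x)).
Proof. by move=> ha; rewrite /code_tail; comp. Qed.

Lemma computes_iter_code_tail g a n : computes g a -> computes g n ->
  computes g (fun x => iter (n x) code_tail (a x)).
Proof.
move=> ha hn; apply: (computes_iter (f := fun=> code_tail)) => //.
by apply: computes_code_tail; comp.
Qed.

Lemma computes_code_bit g a n : computes g a -> computes g n ->
  computes g (fun x => code_bit (a x) (n x)).
Proof. by move=> ha hn; rewrite /code_bit; comp; exact: computes_iter_code_tail. Qed.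

(* Recursion on two smaller arguments: the values at [0, ..., j-1] are kept in a
   nested pair, from which the one at [k] is read after dropping [j - k.+1]. *)
Lemma computes_branching_rec g (G : nat -> nat -> nat -> nat -> nat) a b :
  computes g (fun z => G (p1 z) (p1 (p2 z)) (p1 (p2 (p2 z))) (p2 (p2 (p2 z)))) ->
  computes g a -> computes g b ->
  exists2 F, computes g (fun z => F (p1 z) (p2 z)) &
    forall x i, exists u v, [/\ F x i = G x i u v,
      a i < i -> u = F x (a i) & b i < i -> v = F x (b i)].
Proof.
move=> hG ha hb.
pose look r j k := p2 (iter (j - k.+1) p1 r).
pose next x j r := cpair r (G x j (look r j (a j)) (look r j (b j))).
pose T x i := iteri i (next x) 0.
have lookE x i k : k < i -> look (T x i) i k = p2 (T x k.+1).
  move=> ki; congr p2; rewrite -{2}(subnK ki); elim: (i - k.+1) => // m ih.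
  by rewrite iterSr addSn /T /= p1_cpair.
have hlook r j k : computes g r -> computes g j -> computes g k ->
    computes g (fun x => look (r x) (j x) (k x)).
  move=> hr hj hk; rewrite /look; comp.
  by apply: (computes_iter (f := fun=> p1)); comp.
exists (fun x i => p2 (T x i.+1)).
  apply: computes_p2; apply: (computes_iteri (q := fun z => next (p1 z))); comp.
  rewrite /next; comp.
  pose u z := look (p2 (p2 z)) (p1 (p2 z)) (a (p1 (p2 z))).
  pose v z := look (p2 (p2 z)) (p1 (p2 z)) (b (p1 (p2 z))).
  have hu : computes g u.
    by rewrite /u; apply: hlook; comp; apply: computes_comp ha _; comp.
  have hv : computes g v.
    by rewrite /v; apply: hlook; comp; apply: computes_comp hb _; comp.
  have hz : computes g (fun z => cpair (p1 (p1 z)) (cpair (p1 (p2 z)) (cpair (u z) (v z)))).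
    by comp.
  by apply: computes_ext (computes_comp hG hz) => z; rewrite !pE.
move=> x i; exists (look (T x i) i (a i)), (look (T x i) i (b i)).
by split=> [|/lookE->|/lookE->] //; rewrite /T /= p2_cpair.
Qed.

(* [F (cpair n l) (name_index t)] is the measure under [t] of the reals whose
   first [l] bits satisfy [Q n], times [2 ^ name_index t] to make it an integer. *)
Lemma computes_name_mass g (Q : nat -> nat -> pred bool) :
  computes g (fun z => Q (p1 z) (p1 (p2 z)) (odd (p2 (p2 z)))) ->
  exists2 F, computes g (fun z => F (p1 z) (p2 z)) &
  forall n l, let F := F (cpair n l) \o name_index in
    (forall s, F (Dirac s) = all (fun i => Q n i (nth false s i)) (iota 0 l) *
                             2 ^ name_index (Dirac s)) /\
    (forall t u, let c := (cpair (name_index t) (name_index u)).*2 in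
       F (Average t u) = 2 ^ (c - name_index t) * F t + 2 ^ (c - name_index u) * F u).
Proof.
move=> hQ.
pose test x i := all (fun j => Q (p1 x) j (code_bit i./2 j)) (iota 0 (p2 x)).
(* Odd indices are averages, with the pair of components in [i.-1./2]; even ones are Dirac measures.
   For an average the halving uses up one factor of [2 ^ i], leaving [2 ^ i.-1] to rescale the
   components. *)
pose G x i u v := if odd i then
    2 ^ (i.-1 - p1 i.-1./2) * u + 2 ^ (i.-1 - p2 i.-1./2) * v else test x i * 2 ^ i.
have [|||F hF FE] := @computes_branching_rec g G (fun i => p1 i.-1./2) (fun i => p2 i.-1./2).
- rewrite /G /test; comp.
  apply: (computes_all (t := fun z j => Q (p1 (p1 z)) j (code_bit (p1 (p2 z))./2 j))); comp.
  have hz : computes g (fun z => cpair (p1 (p1 (p1 z)))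
      (cpair (p2 z) (code_bit (p1 (p2 (p1 z)))./2 (p2 z)))).
    by comp; apply: computes_code_bit; comp.
  by apply: computes_ext (computes_comp hQ hz) => z; rewrite !pE oddb.
- by comp.
- by comp.
exists F => // n l /=; split=> [s|t u].
  have [u [v [-> _ _]]] := FE (cpair n l) (string_code s).*2.
  rewrite /G odd_double /test !pE doubleK.
  by under eq_all do rewrite code_bit_nth.
have [m1 [m2 [-> h1 h2]]] :=
  FE (cpair n l) (cpair (name_index t) (name_index u)).*2.+1.
move: h1 h2; rewrite /G /= odd_double /= doubleK !pE.
(* Components are at most their pair, hence below the index of the average, so the recursion has
   already reached them. *)
have := leq_cpair (name_index t) (name_index u).
by move=> le h1 h2; rewrite h1 ?h2 //; lia.
Qed.

(** * Tests from computable families of clopen sets *)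

Local Open Scope ring_scope.

(** Clopen sets given by constraints on single bits. They include both families used later: reals
    vanishing on an interval, and reals sharing an initial segment with a given one. *)
Definition box (q : nat -> pred bool) (l : nat) : set cantor_borel :=
  [set X | all (fun i => q i (X i)) (iota 0 l)].

Lemma measurable_bit i b : measurable [set X : cantor_borel | X i = b].
Proof.
apply: sub_sigma_algebra.
apply: ((@continuousP cantor_space bool (proj i)).1 _ [set b]).
  exact: (@proj_continuous nat (fun=> bool) i).
exact: discrete_open.
Qed.

Lemma measurable_box q l : measurable (box q l).
Proof.
have -> : box q l = \bigcap_(i in `I_l) [set X : cantor_borel | q i (X i)].
  apply/seteqP; split=> X /=.
    by move=> /allP h i /= il; apply: h; rewrite mem_iota.
  by move=> h; apply/allP => i; rewrite mem_iota => il; apply: h.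
apply: bigcap_measurableType => i _.
have -> : [set X : cantor_borel | q i (X i)] =
    (if q i true then [set X : cantor_borel | X i = true] else set0) `|`
    (if q i false then [set X : cantor_borel | X i = false] else set0).
  apply/seteqP; split=> X /=.
    by case e : (X i) => qi; rewrite qi; [left|right].
  by move=> []; case: ifP => //= + ->.
by apply: measurableU; case: ifP => // _; exact: measurable_bit.
Qed.

Lemma cylinder_box s : cylinder s = box (fun i => pred1 (nth false s i)) (size s).
Proof.
apply/seteqP; split=> X; rewrite /cylinder /box /=.
  move=> e; apply/allP => i; rewrite mem_iota /= => il.
  by rewrite -e nth_mkseq.
move=> /allP h; apply: (@eq_from_nth _ false); rewrite size_mkseq // => i il.
by rewrite nth_mkseq //; apply/eqP/h; rewrite mem_iota.
Qed.

Lemma measurable_cylinder s : measurable (cylinder s).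
Proof. by rewrite cylinder_box; exact: measurable_box. Qed.

Definition box_words (q : nat -> pred bool) (l : nat) : set (seq bool) :=
  [set s | size s = l /\ all (fun i => q i (nth false s i)) (iota 0 l)].

Lemma finite_box_words q l : finite_set (box_words q l).
Proof.
apply: (@sub_finite_set _ _ ((fun t : l.-tuple bool => tval t) @` setT)).
  by move=> s [/eqP sl _]; exists (Tuple sl).
exact/finite_image/finite_finset.
Qed.

Lemma box_bigcup q l : box q l = \bigcup_(s in box_words q l) cylinder s.
Proof.
apply/seteqP; split=> X.
  rewrite /box /= => h; exists (mkseq X l); last by rewrite /cylinder /= size_mkseq.
  split; first exact: size_mkseq.
  apply/allP => i il; move/allP: h => /(_ i il).
  by move: il; rewrite mem_iota => il; rewrite nth_mkseq.
move=> [s [sl /allP h]]; rewrite /cylinder /box /= => e; apply/allP => i il.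
have := h i il; rewrite -e sl; move: il; rewrite mem_iota => il.
by rewrite nth_mkseq.
Qed.

(** * Measures of boxes, their approximation, and the resulting tests *)

Section Measures.
Variable R : realType.
Implicit Types mu nu : probability cantor_borel R.

Lemma box_measureE mu q l :
  mu (box q l) = (\sum_(s <- fset_set (box_words q l)) mu (cylinder s))%E.
Proof.
have fin := finite_box_words q l.
rewrite box_bigcup measure_fin_bigcup //; last by move=> s _; exact: measurable_cylinder.
  by rewrite fsbig_finite.
(* Disjointness: two strings of length [l] with a common extension are equal. *)
move=> s t [sl _] [tl _] [X [/= <- <-]].
by rewrite sl tl.
Qed.

(* The strings of length [l] have weight [2 ^- l] in the metric. *)
Lemma box_measure_dist mu nu q l :
  ((`|fine (mu (box q l)) - fine (nu (box q l))|)%:E <=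
   (2 ^+ l)%:E * measure_dist mu nu)%E.
Proof.
rewrite -lee_pdivrMl ?exprn_gt0 //.
apply: esum_ge; exists (box_words q l); first by split; [exact: finite_box_words|].
rewrite fsbig_finite; last exact: finite_box_words.
rewrite !box_measureE /=.
have fin mu' s : mu' (cylinder s) \is a fin_num.
  by apply: fin_num_measure; exact: measurable_cylinder.
rewrite -!sum_fine // -sumrB.
apply: (@le_trans _ _ (\sum_(s <- fset_set (box_words q l))
   (2 ^- l * `|fine (mu (cylinder s)) - fine (nu (cylinder s))|)%:E)%E).
  rewrite sumEFin -mulr_sumr -EFinM lee_fin ler_wpM2l ?invr_ge0 ?exprn_ge0 //.
  exact: ler_norm_sum.
rewrite big_seq [in leRHS]big_seq; apply: lee_sum => s.
rewrite in_fset_set; last exact: finite_box_words.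
move=> /set_mem[sl _]; rewrite sl EFinM lee_wpmul2l ?lee_fin ?invr_ge0 ?exprn_ge0 //.
by rewrite -(fineK (fin mu s)) -(fineK (fin nu s)).
Qed.

(** The steps from [k] on add up to at most [2 * 2 ^- k], and passing from the metric to a box costs
    [2 ^+ l]. The bound is explicit, so an algorithm can choose [k]. *)
Lemma representation_box_dist mu (t : nat -> name) q l k :
  (forall k, (measure_dist (name_measure R (t k)) (name_measure R (t k.+1))
              <= (2 ^- k)%:E)%E) ->
  (fun k => measure_dist (name_measure R (t k)) mu) @ \oo --> 0%E ->
  `|fine (name_measure R (t k) (box q l)) - fine (mu (box q l))| <=
    2 ^+ l * (2 * 2 ^- k).
Proof.
move=> step lim.
pose b j := fine (name_measure R (t j) (box q l)); rewrite -/(b k).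
have step_b j : `|b j - b j.+1| <= 2 ^+ l * 2 ^- j.
  rewrite -lee_fin; apply: le_trans (box_measure_dist _ _ _ _) _.
  by rewrite EFinM lee_wpmul2l // lee_fin exprn_ge0.
(* The subtracted tail of the geometric series is kept so that the induction closes. *)
have tele j : `|b k - b (k + j)%N| <= 2 ^+ l * (2 * 2 ^- k - 2 * 2 ^- (k + j)).
  elim: j => [|j ih]; first by rewrite addn0 !subrr normr0 mulr0.
  rewrite addnS; apply: le_trans (ler_distD (b (k + j)%N) _ _) _.
  apply: le_trans (lerD ih (step_b _)) _.
  rewrite -mulrDr ler_wpM2l ?exprn_ge0 // exprS invfM mulrA divff // mul1r.
  lra.
(* Since [mu] is only a limit, it is compared with a late term up to an arbitrary [e], scaled by
   [2 ^- l] to offset the cost of the box. *)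
apply/ler_addgt0Pr => e e0.
have le0 : 0 < 2 ^- l * e by rewrite mulr_gt0 ?invr_gt0 ?exprn_gt0.
have : \forall j \near \oo, (measure_dist (name_measure R (t j)) mu < (2 ^- l * e)%:E)%E.
  have := lim; move=> /fine_cvgP[] finl /cvgr_lt /(_ _ le0).
  move=> ltl; near=> j.
  have fj : measure_dist (name_measure R (t j)) mu \is a fin_num by near: j.
  by rewrite -(fineK fj) lte_fin; near: j.
move=> [N _ hN].
have {}hN := hN (k + N)%N (leq_addl _ _).
have hb : `|b (k + N)%N - fine (mu (box q l))| <= e.
  rewrite -lee_fin; apply: le_trans (box_measure_dist _ _ _ _) _.
  have -> : e = 2 ^+ l * (2 ^- l * e) by rewrite mulrA divff ?mul1r ?expf_neq0.
  by rewrite EFinM lee_wpmul2l ?lee_fin ?exprn_ge0 // ltW.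
apply: le_trans (ler_distD (b (k + N)%N) _ _) _.
apply: lerD hb; apply: le_trans (tele N) _.
by rewrite ler_wpM2l ?exprn_ge0 // gerBl mulr_ge0 // invr_ge0 exprn_ge0.
Unshelve. all: by end_near. Qed.

(** Continuity from above, as the boxes decrease in [l]. *)
Lemma box_cvg0 mu q : mu (\bigcap_l box q l) = 0%E ->
  forall e, 0 < e -> exists l, fine (mu (box q l)) < e.
Proof.
move=> mu0 e e0.
have : (mu \o box q) @ \oo --> mu (\bigcap_l box q l).
  apply: nonincreasing_cvg_mu => [|l||].
  - by rewrite -ge0_fin_numE // fin_num_measure //; exact: measurable_box.
  - exact: measurable_box.
  - by apply: bigcapT_measurable => l; exact: measurable_box.
  move=> l m lm; apply/subsetPset => X; rewrite /box /= -(subnKC lm) iotaD all_cat.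
  by case/andP.
rewrite mu0 => /fine_cvgP[_ /cvgr_lt /(_ _ e0) [N _ hN]].
by exists N; exact: hN N (leqnn _).
Qed.

(** These measures are dyadic rationals with a known denominator, so comparing them with powers of 2
    is decidable on integers. *)
Lemma computes_name_box_measure g (Q : nat -> nat -> pred bool) :
  computes g (fun z => Q (p1 z) (p1 (p2 z)) (odd (p2 (p2 z)))) ->
  exists2 F, computes g (fun z => F (p1 z) (p2 z)) &
  forall n l t, (name_measure R t (box (Q n) l) =
    ((F (cpair n l) (name_index t))%:R / 2 ^+ name_index t)%:E)%E.
Proof.
move=> /computes_name_mass[F hF FE]; exists F => // n l.
have [FD FA] := FE n l; elim=> [s|t iht u ihu].
  rewrite [F _ _]FD natrM natrX mulfK ?expf_neq0 //= diracE.
  suff -> : (finite_ext s \in box (Q n) l) =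
      all (fun i => Q n i (nth false s i)) (iota 0 l) by [].
  by apply/idP/idP => [/set_mem|h]; last exact: mem_set.
rewrite [F _ _]FA -[name_measure _ _ _]/(average _ _ _) averageE iht ihu.
rewrite -EFinD -EFinM natrD !natrM !natrX; congr EFin.
set c := (cpair _ _).*2.
have le := leq_cpair (name_index t) (name_index u).
(* Brings both summands to the denominator [2 ^ c.+1]; the extra factor 2 comes from the halving in
   the average. *)
have pow i : (i <= c)%N -> 2 ^+ i.+1 * 2 ^+ (c - i) = 2 ^+ c.+1 :> R.
  by move=> ic; rewrite -exprD; congr (_ ^+ _); lia.
have pt := pow (name_index t); have pu := pow (name_index u).
rewrite -[name_index (Average t u)]/c.+1.
have nz i : 2 ^+ i != 0 :> R by rewrite expf_neq0.
rewrite [RHS]mulrDl -[in X in _ = X + _]pt -1?[in X in _ = _ + X]pu; try by rewrite /c; lia.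
rewrite !exprS; move: (nz (name_index t)) (nz (name_index u)).
move: (nz (c - name_index t)%N) (nz (c - name_index u)%N).
move: (2 ^+ _) (2 ^+ _) (2 ^+ _) (2 ^+ _) => w x y z w0 x0 y0 z0.
by field; rewrite ?w0 ?x0 ?y0 ?z0.
Qed.

(** A search through the approximations finds a length [h n] at which the box has measure at most
    [2 ^- n]. A real in infinitely many of these boxes lies in every tail union, and the tail unions
    form a test. *)
Lemma null_boxes_test (mu : probability cantor_borel R) (A : real)
    (Q : nat -> nat -> pred bool) :
  representation A mu ->
  computes (char A) (fun z => Q (p1 z) (p1 (p2 z)) (odd (p2 (p2 z)))) ->
  (forall n, mu (\bigcap_l box (Q n) l) = 0%E) ->
  exists2 h, computes (char A) h &
  forall X, (forall N, exists2 n, (N <= n)%N & box (Q n) (h n) X) ->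
    ~ random A mu X.
Proof.
move=> [t [codes step lim]] hQ mu0.
have [F hF FE] := computes_name_box_measure hQ.
(* The coded sequence is read off its graph by searching for the value. *)
have [k||f hf fE] := @computes_search (char A) (fun k m => A (cpair k m)).
- by exists (name_index (t k)); apply/codes.
- by comp; rewrite /=; apply: (computes_comp (computes_oracle _)); comp.
have {}fE k : f k = name_index (t k) by apply/esym/codes.
have fin nu q l : (nu : probability cantor_borel R) (box q l) \is a fin_num.
  by apply: fin_num_measure; exact: measurable_box.
(* At index [l + n + 3] the error is [2 ^ l * 2 / 2 ^ (l + n + 3)], which is [2 ^- n.+2]. The
   comparison of the approximation with [2 ^- n.+1] is cleared of denominators. *)
pose small n l := (F (cpair n l) (f (l + n + 3)) * 2 ^ n.+1 <= 2 ^ f (l + n + 3))%N.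
have smallE n l : small n l =
    (fine (name_measure R (t (l + n + 3)%N) (box (Q n) l)) <= 2 ^- n.+1).
  rewrite /small FE fE /= ler_pdivrMr ?exprn_gt0 // ler_pdivlMl ?exprn_gt0 //.
  by rewrite mulrC -!natrX -natrM ler_nat.
have err n l : `|fine (name_measure R (t (l + n + 3)%N) (box (Q n) l))
                 - fine (mu (box (Q n) l))| <= 2 ^- n.+2.
  apply: le_trans (representation_box_dist _ _ _ step lim) _.
  rewrite (_ : (l + n + 3 = l + n.+3)%N); last by lia.
  rewrite exprD [2 ^+ n.+3]exprS le_eqVlt; apply/predU1P; left.
  have : 2 ^+ l != 0 :> R by rewrite expf_neq0.
  have : 2 ^+ n.+2 != 0 :> R by rewrite expf_neq0.
  by move: (2 ^+ l) (2 ^+ n.+2) => a b b0 a0; field; rewrite ?a0 ?b0.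
have [n||h hh hsmall] := @computes_search (char A) small.
(* The search ends: a box of true measure below [2 ^- n.+2] passes despite the error. Conversely,
   passing bounds the true measure by [2 ^- n.+1 + 2 ^- n.+2], below [2 ^- n]. *)
- have e0 : 0 < 2 ^- n.+2 :> R by rewrite invr_gt0 exprn_gt0.
  have [l ltl] := box_cvg0 (mu0 n) e0; exists l; rewrite smallE.
  have := err n l; rewrite ler_norml => /andP[_].
  have -> : 2 ^- n.+1 = 2 ^- n.+2 + 2 ^- n.+2 :> R.
    by rewrite [in RHS]exprS invfM; field; rewrite expf_neq0.
  lra.
- rewrite /small; comp.
    have hz : computes (char A) (fun z => cpair (cpair (p1 z) (p2 z)) (f (p2 z + p1 z + 3))%N).
      by comp; apply: (computes_comp hf); comp.
    by apply: computes_ext (computes_comp hF hz) => z; rewrite !pE.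
  by apply: (computes_comp hf); comp.
exists h => // X Xh randX.
(* Only [L > n] is allowed, so that the bounds [2 ^- L] sum to exactly [2 ^- n]. *)
pose V n : set cantor_borel := \bigcup_(L in [set L | (n < L)%N]) box (Q L) (h L).
apply: (randX V) => [|n|n _]; last first.
- by have [L nL XL] := Xh n.+1; exists L.
- have sub : V n `<=` \bigcup_k box (Q (n + k.+1)%N) (h (n + k.+1)%N).
    move=> Y [L /= nL YL]; exists (L - n.+1)%N => //.
    by rewrite (_ : (n + (L - n.+1).+1 = L)%N) //; lia.
  have le1 : (mu (V n) <=
      \sum_(k <oo) mu (box (Q (n + k.+1)%N) (h (n + k.+1)%N)))%E.
    apply: measure_sigma_subadditive => // [k|]; first exact: measurable_box.
    by apply: bigcup_measurable => L _; exact: measurable_box.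
  apply: le_trans le1 _; apply: le_trans _ (epsilon_trick0 xpredT _); last first.
    by rewrite invr_ge0 exprn_ge0.
  apply: lee_nneseries => k _ //.
  rewrite -(fineK (fin _ _ _)) lee_fin natrX -invfM -exprD.
  set L := (n + k.+1)%N.
  have := hsmall L; rewrite smallE.
  have := err L (h L); rewrite ler_norml => /andP[+ _].
  have : 0 < 2 ^- L.+2 :> R by rewrite invr_gt0 exprn_gt0.
  rewrite !exprS !invfM; lra.
(* The middle condition says that the string is longer than [h L], so it decides all constraints;
   strings of length [(h L).+1] already cover the box. *)
pose test x L := [&& p1 x < L, 0 < iter (h L) code_tail (p2 x) &
  all (fun i => Q L i (code_bit (p2 x) i)) (iota 0 (h L))]%N.
have [|p hp] := @halts_search (char A) test.
  rewrite /test; comp.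
    by apply: computes_iter_code_tail; comp; apply: (computes_comp hh); comp.
  apply: (computes_all (t := fun z i => Q (p2 z) i (code_bit (p2 (p1 z)) i))); last first.
    by apply: (computes_comp hh); comp.
  have hz : computes (char A) (fun z => cpair (p2 (p1 z))
      (cpair (p2 z) (code_bit (p2 (p1 (p1 z))) (p2 z)))).
    by comp; apply: computes_code_bit; comp.
  by apply: computes_ext (computes_comp hQ hz) => z; rewrite !pE oddb.
exists p => n; apply/seteqP; split=> Y.
  move=> [L /= nL /allP YL].
  have [s [Ys size_s nth_s]] : exists s, [/\ cylinder s Y, size s = (h L).+1 &
      forall i, (i < (h L).+1)%N -> nth false s i = Y i].
    exists (mkseq Y (h L).+1); split=> [||i]; [|exact: size_mkseq|exact: nth_mkseq].
    by rewrite /cylinder /mkset size_mkseq.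
  exists s => //; apply/hp; exists L.
  rewrite /test !pE nL code_size size_s leqnn; apply/allP => i il.
  rewrite code_bit_nth nth_s; first exact: YL.
  by move: il; rewrite mem_iota => /leqW.
move=> [s /= /hp[L]]; rewrite /test !pE code_size => /and3P[nL hs /allP Qs] Ys.
exists L => //; apply/allP => i il; have := Qs i il; rewrite code_bit_nth -Ys.
by move: il; rewrite mem_iota => il; rewrite nth_mkseq // (ltn_trans il).
Qed.

Lemma bigcap_box_pred1 (X : cantor_borel) :
  \bigcap_l box (fun i => pred1 (X i)) l = [set X].
Proof.
apply/seteqP; split=> [Y /= h|Y -> l _]; last by apply/allP => i _ /=.
by apply/funext => i; have /allP /(_ i) := h i.+1 I; rewrite mem_iota => /(_ (leqnn _))/eqP.
Qed.

Lemma measurable_point (X : cantor_borel) : measurable [set X].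
Proof.
rewrite -bigcap_box_pred1; apply: bigcapT_measurable => l; exact: measurable_box.
Qed.

(** Such a real is determined by its first [L] bits, so the set is covered by the countably many
    points [finite_ext s], each of measure 0. *)
Lemma measure_eventually_zero (mu : probability cantor_borel R) L :
  continuous_measure mu ->
  mu (\bigcap_l box (fun i b => (i < L)%N || ~~ b) l) = 0%E.
Proof.
move=> cont; apply/eqP; rewrite eq_le measure_ge0 andbT.
(* Numbers that code no string give the zero real, which is one more null point. *)
pose F (k : nat) : set cantor_borel := [set finite_ext (odflt [::] (@choice.unpickle (seq bool) k))].
have le1 : (mu (\bigcap_l box (fun i b => (i < L)%N || ~~ b) l) <=
    \sum_(k <oo) mu (F k))%E.
  apply: measure_sigma_subadditive => [k||Y hY]; first exact: measurable_point.
    by apply: bigcapT_measurable => l; exact: measurable_box.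
  exists (choice.pickle (mkseq Y L)) => //; rewrite /F choice.pickleK /=.
  apply/funext => i; rewrite /finite_ext; case: (ltnP i L) => iL.
    by rewrite nth_mkseq.
  rewrite nth_default ?size_mkseq //; apply/negbTE.
  have /allP /(_ i) := hY i.+1 I; rewrite mem_iota => /(_ (leqnn _)).
  by rewrite ltnNge iL.
by apply: le_trans le1 _; rewrite eseries0 // => k _ _; exact: cont.
Qed.

End Measures.

(** * Reals with long gaps *)

Local Open Scope nat_scope.

(** Partial sums of [f i + 1]: strictly increasing and above [f n] for arbitrary [f]. *)
Definition gap_position (f : nat -> nat) (n : nat) : nat :=
  iteri n.+1 (fun i r => r + (f i).+1) 0.

(* Since the [n]-th position exceeds [n], the search may be cut off at [m]. *)
Definition gap_real (f : nat -> nat) : real :=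
  fun m => ~~ all (fun n => gap_position f n != m) (iota 0 m).

Section GapReal.
Variable f : nat -> nat.
Let x := gap_position f.

Lemma gap_position_gt n : f n < x n.
Proof. by rewrite /x /gap_position /= leq_addl. Qed.

Lemma gap_position_lt n : x n < x n.+1.
Proof. by rewrite {2}/x /gap_position /= -/(x n) -addn1 leq_add2l. Qed.

Lemma gap_position_mono : {mono x : m n / m <= n}.
Proof. by apply: leq_mono; apply: homo_ltn gap_position_lt; exact: ltn_trans. Qed.

Lemma gap_position_gt_id n : n < x n.
Proof.
elim: n => [|n ih]; first exact: leq_ltn_trans (gap_position_gt 0).
exact: leq_ltn_trans ih (gap_position_lt n).
Qed.

Lemma gap_realP m : reflect (exists n, x n = m) (gap_real f m).
Proof.
rewrite /gap_real; apply: (iffP allPn) => [[n _]|[n xn]].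
  by rewrite negbK => /eqP; exists n.
by rewrite -xn; exists n; [rewrite mem_iota; exact: gap_position_gt_id|rewrite negbK].
Qed.

Lemma computes_gap_real g : computes g f -> computes g (char (gap_real f)).
Proof.
move=> hf; rewrite /char /gap_real; comp.
apply: (computes_all (t := fun m n => gap_position f n != m)); comp.
rewrite /gap_position; apply: (computes_iteri (q := fun _ i r => r + (f i).+1)); comp.
by apply: (computes_comp hf); comp.
Qed.

(** The real can find an element beyond any given number. Beyond [x n] such an element is at least
    [x n.+1], so the growth lemma applies. *)
Lemma gap_real_dominates :
  exists2 G, computes (char (gap_real f)) G & dominates G f.
Proof.
have [m||h hh hX] := @computes_search (char (gap_real f))
    (fun m j => (m < j) && gap_real f j).
- exists (x m.+1); apply/andP; split; last by apply/gap_realP; exists m.+1.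
  elim: m => [|m ih]; last exact: leq_ltn_trans ih (gap_position_lt _).
  exact: leq_ltn_trans (gap_position_lt 0).
- by comp; apply: (computes_comp (computes_oracle _)); comp.
apply: (dominates_of_growth (x := x) (N := 0) hh) => [|n _]; first exact: gap_position_gt.
have /andP[+ /gap_realP[k xk]] := hX (x n).
by rewrite -xk !(leqW_mono gap_position_mono) gap_position_mono.
Qed.

Lemma gap_real_NCR (R : realType) B :
  modulus f B -> computes (char B) f -> NCR R (gap_real f).
Proof.
move=> mfB Bf [mu [A [cont rep rand]]].
have [||h hh hrand] := null_boxes_test (Q := fun L i b => (i < L) || ~~ b) rep.
- by comp.
- by move=> L; exact: measure_eventually_zero.
have [N gapN] : exists N, forall n, N <= n -> x n.+1 <= h (x n).+1.
  apply: contrapT => noN; apply: hrand rand => N.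
  have [n Nn hn] : exists2 n, N <= n & h (x n).+1 < x n.+1.
    apply: contrapT => non; apply: noN; exists N => n Nn; rewrite leqNgt.
    by apply/negP => hn; apply: non; exists n.
  (* The box starts just after the element [x n] and ends before the next one, so the real vanishes
     in between. Its index exceeds [N] because [n < x n]. *)
  exists (x n).+1.
    exact: leq_trans Nn (leqW (ltnW (gap_position_gt_id n))).
  apply/allP => i; rewrite mem_iota /= => il; rewrite ltnS -implyNb -ltnNge.
  apply/implyP => ni; apply/negP => /gap_realP[k xk].
  move: ni (ltn_trans il hn); rewrite -xk !(leqW_mono gap_position_mono).
  by rewrite ltnS => ? ?; lia.
have [|G hG domG] := @dominates_of_growth (char A) f x (fun m => h m.+1) N _
    gap_position_gt gapN.
  exact: computes_comp hh (computes_succ (computes_id _)).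
(* The dominating [G] gives [B] by [mfB], then [Bf] gives [f], and [f] gives the real. *)
have AX : computes (char A) (char (gap_real f)).
  exact/computes_gap_real/(computes_trans _ Bf)/(computes_trans hG)/mfB.
(* The second family ignores its index: its boxes shrink to the real itself, a null point by
   continuity of [mu]. *)
have [||h' _ hrand'] := null_boxes_test (Q := fun _ i => pred1 (gap_real f i)) rep.
- apply: (@computes_ext _ (fun z =>
    odd (p2 (p2 z)) == gap_real f (p1 (p2 z)) :> nat)).
    by move=> z /=; case: (odd _); case: (gap_real _ _).
  by comp; apply: (computes_comp AX); comp.
- by move=> _; rewrite bigcap_box_pred1.
by apply: hrand' rand => M; exists M => //; apply/allP => i _ /=.
Qed.

End GapReal.

(** The gap real stays in the degree: it computes a function dominating [f], hence [B], while [B]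
    computes [f], hence the gap real. *)
Lemma self_modulus_degree_NCR (R : realType) D :
  self_modulus_degree D -> exists2 X : real, D X & NCR R X.
Proof.
move=> [[A ->] [B [BA AB] [f [mfB Bf _]]]].
exists (gap_real f); last exact: gap_real_NCR mfB Bf.
have BX : turing_le B (gap_real f).
  by have [G hG /mfB] := gap_real_dominates f; exact: computes_trans.
have XB : turing_le (gap_real f) B by exact: computes_gap_real.
by split; [exact: computes_trans BA XB|exact: computes_trans BX AB].
Qed.

Theorem theorem1p1 (R : realType) :
  (forall n : nat, (1 <= n)%N ->
     forall D : set real, nREA_degree n D -> exists2 X : real, D X & NCR R X) /\
  (forall D : set real, self_modulus_degree D -> exists2 X : real, D X & NCR R X).
Proof.
split=> [n _ D [degD [A DA reaA]]|D]; last exact: self_modulus_degree_NCR.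
apply: self_modulus_degree_NCR; split=> //.
by exists A => //; exact: nREA_self_modulus reaA.
Qed.
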